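(* Let $\{X_\alpha\}_{\alpha\in\Gamma}$ be a family of real Banach spaces. Then the $c_0$-sum $X=\bigoplus_{c_0}X_\alpha$ is nicely smooth if and only if $X_\alpha$ is nicely smooth for each $\alpha\in\Gamma$.
   Context: All Banach spaces are real. $\bigoplus_{c_0}X_\alpha$ is the space of all $x=(x_\alpha)_{\alpha\in\Gamma}$ with $x_\alpha\in X_\alpha$ such that $\{\alpha:\|x_\alpha\|>\varepsilon\}$ is finite for every $\varepsilon>0$, with norm $\sup_\alpha\|x_\alpha\|$. A set $A\subseteq B(X^* )$ (closed unit ball of $X^*$) is a norming set for $X$ if $\|x\|=\sup\{x^*(x):x^*\in A\}$ for all $x\in X$. A closed subspace $F\subseteq X^*$ is a norming subspace if its closed unit ball $B(F)$ is a norming set for $X$. $X$ is nicely smooth if $X^*$ contains no proper norming (closed) subspace. *)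

(* Defs.v *)
From HB Require Import structures.
From mathcomp Require Import all_boot all_order all_algebra.
From mathcomp Require Import all_classical all_reals all_analysis.

Set Implicit Arguments.
Unset Strict Implicit.
Unset Printing Implicit Defensive.

Import Order.TTheory GRing.Theory Num.Theory.
Import numFieldNormedType.Exports.

Local Open Scope classical_set_scope.
Local Open Scope ring_scope.

Lemma sup_le_nonneg (R : realType) (E : set R) (M : R) :
  0 <= M -> ubound E M -> sup E <= M.
Proof.
move=> M0 EM; have [->|/set0P E0] := eqVneq E set0; first by rewrite sup0.
exact: ge_sup.
Qed.

Record dual (R : realType) (V : normedModType R) := Dual {
  dual_fun :> V -> R^o;
  dual_linear : linear dual_fun;
  dual_continuous : continuous dual_fun }.

Section dual_lmodule.
Context (R : realType) (V : normedModType R).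
Implicit Types f g : dual V.

HB.instance Definition _ f :=
  GRing.isLinear.Build R V R^o _ (dual_fun f) (dual_linear f).

Lemma dual_eqP f g : f =1 g -> f = g.
Proof.
case: f g => [f lf cf] [g lg cg] /= /funext fg.
by case: _ / fg in lg cg *; congr Dual; exact: Prop_irrelevance.
Qed.

HB.instance Definition _ := gen_eqMixin (dual V).
HB.instance Definition _ := gen_choiceMixin (dual V).

Definition dual_zero : dual V.
Proof.
apply: (@Dual _ _ (fun=> 0)) => [a x y|x]; last exact: cvg_cst.
by rewrite scaler0 addr0.
Defined.

Definition dual_add f g : dual V.
Proof.
apply: (@Dual _ _ (fun x => f x + g x)) => [a x y|x].
  by rewrite !linearP scalerDr addrACA.
by apply: cvgD; exact: dual_continuous.
Defined.

Definition dual_opp f : dual V.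
Proof.
apply: (@Dual _ _ (fun x => - f x)) => [a x y|x].
  by rewrite linearP opprD scalerN.
by apply: cvgN; exact: dual_continuous.
Defined.

Definition dual_scale (a : R) f : dual V.
Proof.
apply: (@Dual _ _ (fun x => a *: f x)) => [b x y|x].
  by rewrite linearP scalerDr !scalerA mulrC.
by apply: cvgZr; exact: dual_continuous.
Defined.

Fact dual_addA : associative dual_add.
Proof. by move=> f g h; apply: dual_eqP => x /=; rewrite addrA. Qed.
Fact dual_addC : commutative dual_add.
Proof. by move=> f g; apply: dual_eqP => x /=; rewrite addrC. Qed.
Fact dual_add0 : left_id dual_zero dual_add.
Proof. by move=> f; apply: dual_eqP => x /=; rewrite add0r. Qed.
Fact dual_addN : left_inverse dual_zero dual_opp dual_add.
Proof. by move=> f; apply: dual_eqP => x /=; rewrite addNr. Qed.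

HB.instance Definition _ :=
  GRing.isZmodule.Build (dual V) dual_addA dual_addC dual_add0 dual_addN.

Fact dual_scaleA (a b : R) f :
  dual_scale a (dual_scale b f) = dual_scale (a * b) f.
Proof. by apply: dual_eqP => x /=; rewrite scalerA. Qed.
Fact dual_scale1 : left_id 1 dual_scale.
Proof. by move=> f; apply: dual_eqP => x /=; rewrite scale1r. Qed.
Fact dual_scaleDr : right_distributive dual_scale +%R.
Proof. by move=> a f g; apply: dual_eqP => x /=; rewrite scalerDr. Qed.
Fact dual_scaleDl f : {morph dual_scale^~ f : a b / a + b}.
Proof. by move=> a b; apply: dual_eqP => x /=; rewrite scalerDl. Qed.

HB.instance Definition _ := GRing.Zmodule_isLmodule.Build R (dual V)
  dual_scaleA dual_scale1 dual_scaleDr dual_scaleDl.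

Definition dual_norm f : R := sup [set `|f x| | x in [set x | `|x| <= 1]].

Lemma dual_has_ubound f :
  has_ubound [set `|f x| | x in [set x | `|x| <= 1]].
Proof.
have /linear_boundedP : bounded_near f (nbhs (0 : V)).
  by apply/linear_bounded_continuous; exact: dual_continuous.
case/pinfty_ex_gt0 => r r0 fr; exists r => _ [x /= x1 <-].
by rewrite (le_trans (fr x))// ler_piMr// ltW.
Qed.

Lemma dual_norm_ub f x : `|x| <= 1 -> `|f x| <= dual_norm f.
Proof. by move=> x1; apply: ub_le_sup; [exact: dual_has_ubound|exists x]. Qed.

Lemma dual_norm_ge0 f : 0 <= dual_norm f.
Proof. by rewrite (le_trans _ (@dual_norm_ub f 0 _)) ?normr0. Qed.

Lemma dual_norm_le f M : 0 <= M -> (forall x, `|x| <= 1 -> `|f x| <= M) ->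
  dual_norm f <= M.
Proof. by move=> M0 fM; apply: sup_le_nonneg => // _ [x x1 <-]; exact: fM. Qed.

Fact dual_normD f g : dual_norm (f + g) <= dual_norm f + dual_norm g.
Proof.
apply: dual_norm_le => [|x x1]; first by rewrite addr_ge0 ?dual_norm_ge0.
by rewrite (le_trans (ler_normD _ _))// lerD// dual_norm_ub.
Qed.

Let dual_normZ_le (a : R) f : dual_norm (a *: f) <= `|a| * dual_norm f.
Proof.
apply: dual_norm_le => [|x x1]; first by rewrite mulr_ge0 ?dual_norm_ge0.
by rewrite [(a *: f) x]/(a *: f x) normrZ ler_wpM2l// dual_norm_ub.
Qed.

Fact dual_normZ (a : R) f : dual_norm (a *: f) = `|a| * dual_norm f.
Proof.
apply/eqP; rewrite eq_le dual_normZ_le /=.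
have [->|a0] := eqVneq a 0; first by rewrite normr0 mul0r dual_norm_ge0.
rewrite -ler_pdivlMl ?normr_gt0// -normfV.
by rewrite (le_trans _ (dual_normZ_le _ _))// scalerA mulVf// scale1r.
Qed.

Fact dual_norm0_eq0 f : dual_norm f = 0 -> f = 0.
Proof.
move=> f0; apply: dual_eqP => x; have [->|x0] := eqVneq x 0.
  by rewrite !linear0.
have := @dual_norm_ub f (`|x|^-1 *: x); rewrite normfZV// lexx f0 => /(_ isT).
by rewrite normr_le0 linearZ scaler_eq0 invr_eq0 normr_eq0 (negPf x0) => /eqP.
Qed.

HB.instance Definition _ :=
  Lmodule_isNormed.Build R (dual V) dual_normD dual_normZ dual_norm0_eq0.

End dual_lmodule.

Record c0sum (R : realType) (I : Type) (X : I -> normedModType R) := C0sum {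
  c0sum_fun :> forall i, X i;
  c0sum_finite :
    forall e : R, 0 < e -> finite_set [set i | e < `|c0sum_fun i|] }.

Section c0sum_lmodule.
Context (R : realType) (I : Type) (X : I -> normedModType R).
Implicit Types x y : c0sum X.

Lemma c0sum_eqP x y : (forall i, x i = y i) -> x = y.
Proof.
case: x y => [x fx] [y fy] /= xy.
have {}xy : x = y by exact: functional_extensionality_dep.
by case: _ / xy in fy *; congr C0sum; exact: Prop_irrelevance.
Qed.

HB.instance Definition _ := gen_eqMixin (c0sum X).
HB.instance Definition _ := gen_choiceMixin (c0sum X).

Definition c0sum_zero : c0sum X.
Proof.
apply: (@C0sum _ _ _ (fun=> 0)) => e e0.
by apply: (@sub_finite_set _ _ set0) => // i /=; rewrite normr0 ltNge ltW.
Defined.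

Definition c0sum_add x y : c0sum X.
Proof.
apply: (@C0sum _ _ _ (fun i => x i + y i)) => e e0.
have e20 : 0 < e / 2 by rewrite divr_gt0.
apply: (@sub_finite_set _ _
    ([set i | e / 2 < `|x i|] `|` [set i | e / 2 < `|y i|])); last first.
  by rewrite finite_setU; split; exact: c0sum_finite.
move=> i /= exy; rewrite !ltNge; apply/orP; rewrite -negb_and.
apply: contraTN exy => /andP[xe ye]; rewrite -leNgt.
by rewrite (le_trans (ler_normD _ _))// [leRHS]splitr lerD.
Defined.

Definition c0sum_opp x : c0sum X.
Proof.
apply: (@C0sum _ _ _ (fun i => - x i)) => e e0.
by under eq_set do rewrite normrN; exact: c0sum_finite.
Defined.

Definition c0sum_scale (a : R) x : c0sum X.
Proof.
apply: (@C0sum _ _ _ (fun i => a *: x i)) => e e0.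
have a1 : 0 < `|a| + 1 by rewrite ltr_wpDl.
apply: (@sub_finite_set _ _ [set i | e / (`|a| + 1) < `|x i|]); last first.
  by apply: c0sum_finite; rewrite divr_gt0.
move=> i /=; rewrite normrZ ltr_pdivrMr// => /lt_le_trans; apply.
by rewrite mulrC ler_wpM2l// lerDl.
Defined.

Fact c0sum_addA : associative c0sum_add.
Proof. by move=> x y z; apply: c0sum_eqP => i /=; rewrite addrA. Qed.
Fact c0sum_addC : commutative c0sum_add.
Proof. by move=> x y; apply: c0sum_eqP => i /=; rewrite addrC. Qed.
Fact c0sum_add0 : left_id c0sum_zero c0sum_add.
Proof. by move=> x; apply: c0sum_eqP => i /=; rewrite add0r. Qed.
Fact c0sum_addN : left_inverse c0sum_zero c0sum_opp c0sum_add.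
Proof. by move=> x; apply: c0sum_eqP => i /=; rewrite addNr. Qed.

HB.instance Definition _ :=
  GRing.isZmodule.Build (c0sum X) c0sum_addA c0sum_addC c0sum_add0 c0sum_addN.

Fact c0sum_scaleA (a b : R) x :
  c0sum_scale a (c0sum_scale b x) = c0sum_scale (a * b) x.
Proof. by apply: c0sum_eqP => i /=; rewrite scalerA. Qed.
Fact c0sum_scale1 : left_id 1 c0sum_scale.
Proof. by move=> x; apply: c0sum_eqP => i /=; rewrite scale1r. Qed.
Fact c0sum_scaleDr : right_distributive c0sum_scale +%R.
Proof. by move=> a x y; apply: c0sum_eqP => i /=; rewrite scalerDr. Qed.
Fact c0sum_scaleDl x : {morph c0sum_scale^~ x : a b / a + b}.
Proof. by move=> a b; apply: c0sum_eqP => i /=; rewrite scalerDl. Qed.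

HB.instance Definition _ := GRing.Zmodule_isLmodule.Build R (c0sum X)
  c0sum_scaleA c0sum_scale1 c0sum_scaleDr c0sum_scaleDl.

(* For an empty [I] the sum is the zero space, and [sup set0 = 0]. *)
Definition c0sum_norm x : R := sup (range (fun i => `|x i|)).

Lemma c0sum_has_ubound x : has_ubound (range (fun i => `|x i|)).
Proof.
have /(finite_image (fun i => `|x i|)) /finite_compact /compact_bounded :=
  c0sum_finite x ltr01.
case/pinfty_ex_gt0 => M M0 xM; exists (Num.max 1 M) => _ [i _ <-].
rewrite le_max; have [//|x1 /=] := leP `|x i| 1.
by rewrite -[leLHS]normr_id; apply: xM; exists i.
Qed.

Lemma c0sum_norm_ub x i : `|x i| <= c0sum_norm x.
Proof. by apply: ub_le_sup; [exact: c0sum_has_ubound|exists i]. Qed.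

Lemma c0sum_norm_le x M : 0 <= M -> (forall i, `|x i| <= M) ->
  c0sum_norm x <= M.
Proof. by move=> M0 xM; apply: sup_le_nonneg => // _ [i _ <-]; exact: xM. Qed.

Lemma c0sum_norm_ge0 x : 0 <= c0sum_norm x.
Proof.
have [i|nI] := pselect (inhabited I).
  by case: i => i; rewrite (le_trans _ (c0sum_norm_ub x i)).
suff r0 : range (fun i => `|x i|) = set0 by rewrite /c0sum_norm r0 sup0.
by rewrite -subset0 => r [i _ _]; case: nI.
Qed.

Fact c0sum_normD x y : c0sum_norm (x + y) <= c0sum_norm x + c0sum_norm y.
Proof.
apply: c0sum_norm_le => [|i]; first by rewrite addr_ge0 ?c0sum_norm_ge0.
by rewrite (le_trans (ler_normD _ _))// lerD// c0sum_norm_ub.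
Qed.

Let c0sum_normZ_le (a : R) x : c0sum_norm (a *: x) <= `|a| * c0sum_norm x.
Proof.
apply: c0sum_norm_le => [|i]; first by rewrite mulr_ge0 ?c0sum_norm_ge0.
by rewrite [(a *: x) i]/(a *: x i) normrZ ler_wpM2l// c0sum_norm_ub.
Qed.

Fact c0sum_normZ (a : R) x : c0sum_norm (a *: x) = `|a| * c0sum_norm x.
Proof.
apply/eqP; rewrite eq_le c0sum_normZ_le /=.
have [->|a0] := eqVneq a 0; first by rewrite normr0 mul0r c0sum_norm_ge0.
rewrite -ler_pdivlMl ?normr_gt0// -normfV.
by rewrite (le_trans _ (c0sum_normZ_le _ _))// scalerA mulVf// scale1r.
Qed.

Fact c0sum_norm0_eq0 x : c0sum_norm x = 0 -> x = 0.
Proof.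
move=> x0; apply: c0sum_eqP => i; apply/eqP.
by rewrite -normr_le0 -x0 c0sum_norm_ub.
Qed.

HB.instance Definition _ :=
  Lmodule_isNormed.Build R (c0sum X) c0sum_normD c0sum_normZ c0sum_norm0_eq0.

End c0sum_lmodule.

Section c0sum_complete.
Context (R : realType) (I : Type) (X : I -> completeNormedModType R).

Lemma c0sum_complete (F : set_system (c0sum X)) :
  ProperFilter F -> cauchy F -> cvg F.
Proof.
move=> FF /cauchy_ballP Fc.
have Fx (e : R) : 0 < e ->
    \forall x & y \near F,
      forall i, `|(x : c0sum X) i - (y : c0sum X) i| < e.
  move=> /Fc; apply: filterS => -[x y] /= xy i.
  by apply: le_lt_trans xy; exact: (@c0sum_norm_ub _ _ _ (x - y)).
have cvi i : cvg ((x : c0sum X) i @[x --> F]).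
  apply: cauchy_cvg; apply/cauchy_ballP => e e0.
  rewrite near_map2.
  by apply: filterS (Fx _ e0) => -[x y] /= /(_ i); rewrite -ball_normE.
pose l i := lim ((x : c0sum X) i @[x --> F]).
have Fl (e : R) : 0 < e ->
    \forall x \near F, forall i, `|l i - (x : c0sum X) i| <= e.
  move=> e0; have e20 : 0 < e / 2 by rewrite divr_gt0.
  have /nearP_dep := Fx _ e20; apply: filterS => x Fxy i; near F => y.
  have xy j : `|x j - y j| < e / 2 by move: j; near: y.
  rewrite -(subrKA (y i)) (le_trans (ler_normD _ _))// [leRHS]splitr lerD//.
    by near: y; exact: cvgr_dist_le (cvi i) _ e20.
  by rewrite distrC ltW.
have l0 (e : R) : 0 < e -> finite_set [set i | e < `|l i|].
  move=> e0; have e20 : 0 < e / 2 by rewrite divr_gt0.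
  have /filter_ex[x lx] := Fl _ e20.
  apply: (sub_finite_set _ (c0sum_finite x e20)) => i /= eli.
  rewrite -(ltrD2l (e / 2)) -splitr (lt_le_trans eli)//.
  by rewrite -[l i](subrK (x i)) (le_trans (ler_normD _ _))// lerD2r; exact: lx.
apply/cvg_ex; exists (C0sum l0); apply/cvgrPdist_le => e e0.
apply: filterS (Fl _ e0) => x lx.
by apply: c0sum_norm_le => //; exact: ltW.
Unshelve. all: by end_near. Qed.

HB.instance Definition _ := Uniform_isComplete.Build (c0sum X) c0sum_complete.

End c0sum_complete.

Section nicely_smooth.
Context (R : realType).

(* The supremum is taken in [\bar R], where [ereal_sup set0 = -oo]; the real
   [sup] would make the empty set norming for the zero space. *)
Definition norming_set (V : normedModType R) (A : set (dual V)) : Prop :=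
  A `<=` [set f | `|f| <= 1] /\
  forall x : V, `|x|%:E = ereal_sup [set (f x)%:E | f in A].

Definition norming_subspace (V : normedModType R) (F : set (dual V)) : Prop :=
  [/\ submod_closed [in F], closed F & norming_set (F `&` [set f | `|f| <= 1])].

Definition nicely_smooth (V : completeNormedModType R) : Prop :=
  ~ exists2 F : set (dual V), norming_subspace F & F `<` setT.

End nicely_smooth.

(* Main.v *)
From HB Require Import structures.
Require Import Defs.
From mathcomp Require Import all_boot all_order all_algebra.
From mathcomp Require Import all_classical all_reals all_analysis.
From mathcomp Require Import lra.
Import numFieldNormedType.Exports.

Set Implicit Arguments.
Unset Strict Implicit.
Unset Printing Implicit Defensive.

Import Order.TTheory GRing.Theory Num.Theory.

Local Open Scope classical_set_scope.
Local Open Scope ring_scope.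

(** Write [X] for the [c0]-sum.  A subspace of a dual is norming as soon as
    every [M >= 0] satisfying [f x <= M * `|f|] on it dominates [`|x|]
    ([norming_setP]), and this scale-free form is used throughout.

    If [X] is nicely smooth and [G] is a norming subspace of the dual of
    [X i], the functionals on [X] whose restriction to the [i]-th summand lies
    in [G] form a norming subspace [F] of the dual of [X]: the [i]-th coordinate
    of a vector is normed by [G], and any other coordinate by a Hahn-Banach
    functional of its own summand, which restricts to [0] on [X i].  So [F] is
    everything, hence so is [G] ([norming_subspace_restr]).

    Conversely let all [X i] be nicely smooth and [F] be a proper norming
    subspace of the dual of [X].  Hahn-Banach gives a nonzero [phi] of norm at
    most [1] on that dual that vanishes on [F] ([separating_functional]).  The
    dual of [X] is the [l1]-sum of the duals of the summands; only two traces of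
    this are used.  First, functionals depending on a single coordinate are
    total, so [phi] is nonzero on those of some [X i] ([coord_total]), and its
    kernel there is a proper closed subspace [G] of the dual of [X i].  Second,
    if [g] is the restriction of [f] to [X i], then [f] lies at distance at most
    [`|f| - `|g|] from the functional that [g] induces on [X]
    ([coord_restr_l1]).  A functional [f] in [F] that almost norms a vector
    [x] of [X i] has [`|g|] close to [`|f|]; as [phi f = 0], this makes [phi]
    small on [g], so [g] is close to [G].  Thus [G] norms [x] too
    ([norming_subspace_ker]), contradicting the nice smoothness of [X i]. *)

(** * The Hahn-Banach theorem for sublinear functionals *)

Section hahn_banach.
Context (R : realType) (V : lmodType R).
Implicit Types (p q : V -> R) (S : set (V -> R)).

(** Only one inequality of positive homogeneity is required: it is easier to
    check for infima, and applying it to [a] and [a^-1] gives the equality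
    ([sublinearZ]). *)
Definition sublinear p :=
  (forall x y, p (x + y) <= p x + p y) /\
  (forall a x, 0 < a -> p (a *: x) <= a * p x).

Lemma sublinearZ p a x : sublinear p -> 0 < a -> p (a *: x) = a * p x.
Proof.
move=> [_ pZ] a0; apply/eqP; rewrite eq_le pZ//= -ler_pdivlMl//.
by rewrite (le_trans _ (pZ _ _ _)) ?invr_gt0// scalerA mulVf ?gt_eqF// scale1r.
Qed.

Lemma sublinear0 p : sublinear p -> p 0 = 0.
Proof.
move=> ps; have := @sublinearZ p 2 0 ps (ltr0n _ 2).
by rewrite scaler0; lra.
Qed.

Lemma sublinearN p x : sublinear p -> - p (- x) <= p x.
Proof.
move=> ps; have := ps.1 x (- x).
by rewrite subrr (sublinear0 ps); lra.
Qed.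

Definition pointwise_inf S : V -> R := fun x => inf [set q x | q in S].

Lemma pointwise_inf_le S q x : (forall x, has_lbound [set q x | q in S]) ->
  S q -> pointwise_inf S x <= q x.
Proof. by move=> lS Sq; apply: ge_inf => //; exists q. Qed.

(** The two closure conditions cover the three infima needed below: over the
    tilts of a functional, over a chain, and over the distances to the points of
    a subspace. *)
Lemma pointwise_inf_sublinear S : S !=set0 ->
  (forall x, has_lbound [set q x | q in S]) ->
  (forall q r x y, S q -> S r -> exists2 s, S s & s (x + y) <= q x + r y) ->
  (forall q a x, S q -> 0 < a -> exists2 r, S r & r (a *: x) <= a * q x) ->
  sublinear (pointwise_inf S).
Proof.
move=> [q0 Sq0] lS SD SZ.
have infP x c : (forall q, S q -> c <= q x) -> c <= pointwise_inf S x.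
  move=> cS; apply: lb_le_inf; first by exists (q0 x), q0.
  by move=> _ [q Sq <-]; exact: cS.
split=> [x y|a x a0].
  rewrite -lerBlDr; apply: (infP) => q Sq; rewrite lerBlDr -lerBlDl.
  apply: (infP) => r Sr; rewrite lerBlDl; have [s Ss] := SD _ _ x y Sq Sr.
  by apply: le_trans; exact: pointwise_inf_le.
rewrite -ler_pdivrMl//; apply: (infP) => q Sq; rewrite ler_pdivrMl//.
have [r Sr] := SZ _ _ x Sq a0.
by apply: le_trans; exact: pointwise_inf_le.
Qed.

(** The infimum of this family lies below [q] (take [t = 0]) and, at [x], below
    [q (x + v) - q v] (take [t = 1]).  This serves twice in [hahn_banach]: a
    minimal [q] equals the infimum, which makes it additive; and any linear
    functional below the infimum for [p] is at most [- p v] at [- v], hence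
    agrees with [p] at [v]. *)
Definition tilt q v : set (V -> R) :=
  [set (fun x => q (x + t *: v) - t * q v) | t in [set t | 0 <= t]].

Lemma tilt_lbound q v x : sublinear q -> has_lbound [set r x | r in tilt q v].
Proof.
move=> qs; exists (- q (- x)) => _ [_ [t /= t0 <-] <-].
have := qs.1 (x + t *: v) (- x); rewrite addrAC subrr add0r.
have -> : q (t *: v) = t * q v.
  move: t0; rewrite le_eqVlt => /predU1P[<-|]; last exact: sublinearZ.
  by rewrite scale0r mul0r sublinear0.
lra.
Qed.

Lemma tilt_sublinear q v : sublinear q -> sublinear (pointwise_inf (tilt q v)).
Proof.
move=> qs; apply: pointwise_inf_sublinear => [|x|_ _ x y [s s0 <-] [t t0 <-]|
  _ a x [t t0 <-] a0].
- by exists (fun x => q (x + 0 *: v) - 0 * q v), 0 => /=.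
- exact: tilt_lbound.
- exists (fun x => q (x + (s + t) *: v) - (s + t) * q v).
    by exists (s + t) => //=; exact: addr_ge0.
  have := qs.1 (x + s *: v) (y + t *: v).
  by rewrite addrACA -scalerDl; lra.
- exists (fun x => q (x + (a * t) *: v) - (a * t) * q v).
    by exists (a * t) => //=; rewrite mulr_ge0 // ltW.
  by rewrite -scalerA -scalerDr sublinearZ// mulrBr mulrA.
Qed.

Lemma tilt_le q v x t : sublinear q -> 0 <= t ->
  pointwise_inf (tilt q v) x <= q (x + t *: v) - t * q v.
Proof.
move=> qs t0.
apply: (@pointwise_inf_le (tilt q v) (fun x => q (x + t *: v) - t * q v)).
  by move=> y; exact: tilt_lbound.
by exists t.
Qed.

(** Zorn's lemma; a chain of sublinear functionals below [p] has a sublinear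
    infimum, bounded below at [x] by [- p (- x)]. *)
Lemma sublinear_minimal p : sublinear p -> exists q,
  [/\ sublinear q, forall x, q x <= p x &
      forall r, sublinear r -> (forall x, r x <= q x) -> r = q].
Proof.
move=> ps; pose T := {q | sublinear q /\ forall x, q x <= p x}.
pose leT (q r : T) := `[< forall x, sval r x <= sval q x >].
have [||||[q [qs qp]] qmin] := @Zorn T leT.
- by move=> q; apply/asboolP.
- move=> q r s /asboolP qr /asboolP rs; apply/asboolP => x.
  exact: le_trans (qr x).
- move=> [q ?] [r ?] /asboolP /= qr /asboolP /= rq; apply/eq_exist/funext => x.
  by apply: le_anti; rewrite qr rq.
- move=> A Atot; have [->|/set0P A0] := eqVneq A set0.
    by exists (exist _ p (conj ps (fun x => lexx (p x)))).
  pose S := [set sval q | q in A].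
  have S0 : S !=set0 by case: A0 => q Aq; exists (sval q), q.
  have lS x : has_lbound [set q x | q in S].
    exists (- p (- x)) => _ [_ [[q [qs qp]] _ <-] <-] /=.
    by rewrite (le_trans _ (sublinearN x qs))// lerN2.
  have Ss : sublinear (pointwise_inf S).
    apply: pointwise_inf_sublinear => // [_ _ x y [q Aq <-] [r Ar <-]|
        _ a x [q Aq <-] a0]; last first.
      by exists (sval q); [exists q|exact: (svalP q).1.2].
    case: (Atot _ _ Aq Ar) => /asboolP qr.
      exists (sval r); first by exists r.
      by apply: le_trans ((svalP r).1.1 x y) _; rewrite lerD2r.
    exists (sval q); first by exists q.
    by apply: le_trans ((svalP q).1.1 x y) _; rewrite lerD2l.
  have Sp x : pointwise_inf S x <= p x.
    case: A0 => q Aq; apply: le_trans ((svalP q).2 x).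
    by apply: pointwise_inf_le => //; exists q.
  exists (exist _ (pointwise_inf S) (conj Ss Sp) : T) => q Aq; apply/asboolP.
  by move=> x; apply: pointwise_inf_le => //; exists q.
- exists q; split=> // r rs rq.
  have rp x : r x <= p x by exact: le_trans (rq x) _.
  have /qmin/(congr1 sval)// : leT (exist _ q (conj qs qp))
                                (exist _ r (conj rs rp)).
  exact/asboolP.
Qed.

(** A minimal sublinear functional [q] is linear: being equal to the infimum of
    its tilts along [y], it satisfies [q x <= q (x + y) - q y]. *)
Lemma hahn_banach p v : sublinear p ->
  exists2 phi : {linear V -> R^o}, (forall x, phi x <= p x) & phi v = p v.
Proof.
move=> ps; have [q [qs qp qmin]] := sublinear_minimal (tilt_sublinear v ps).
have qD x y : q (x + y) = q x + q y.
  apply/le_anti; rewrite qs.1/=.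
  have /qmin tq : sublinear (pointwise_inf (tilt q y)) by exact: tilt_sublinear.
  rewrite -lerBrDr -{1}tq => [|z].
    by have := @tilt_le q y x 1 qs ler01; rewrite scale1r mul1r.
  by have := @tilt_le q y z 0 qs (lexx _); rewrite scale0r addr0 mul0r subr0.
have qN x : q (- x) = - q x.
  by have := qD x (- x); rewrite subrr sublinear0//; lra.
have ql : linear (q : V -> R^o).
  move=> a x y; rewrite qD; congr (_ + _).
  have [a0|a0|->] := ltgtP a 0; last by rewrite !scale0r sublinear0.
  - apply: oppr_inj; rewrite -qN -scaleNr sublinearZ ?oppr_gt0//.
    exact: mulNr.
  - exact: sublinearZ.
have qp' x : q x <= p x.
  apply: le_trans (qp x) _.
  by have := @tilt_le p v x 0 ps (lexx _); rewrite scale0r addr0 mul0r subr0.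
pose qL := GRing.isLinear.Build R V R^o _ _ ql.
pose phi : {linear V -> R^o} := HB.pack (q : V -> R^o) qL.
exists phi => //=; apply/le_anti; rewrite qp'/=.
have := qp (- v); have := @tilt_le p v (- v) 1 ps ler01.
by rewrite scale1r mul1r addNr sublinear0// qN; lra.
Qed.

End hahn_banach.

(** * Dual spaces and the transposes of contractions *)

Section dual_space.
Context (R : realType).
Implicit Types V W : normedModType R.

Lemma nonexpansive_continuous V W (T : V -> W) :
  (forall x y, `|T x - T y| <= `|x - y|) -> continuous T.
Proof.
move=> Tle x; apply/cvgrPdist_lt => e e0; near=> y.
apply: le_lt_trans (Tle _ _) _; near: y.
exact: (@cvgr_dist_lt _ _ _ (nbhs x) _ id).
Unshelve. all: by end_near. Qed.

Lemma dual_le V (f : dual V) x : f x <= `|f| * `|x|.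
Proof.
have [->|x0] := eqVneq x 0; first by rewrite linear0 normr0 mulr0.
rewrite -ler_pdivrMr ?normr_gt0//; apply: le_trans (ler_norm _) _.
have <- : f (`|x|^-1 *: x) = f x / `|x| by rewrite linearZ; exact: mulrC.
by apply: dual_norm_ub; rewrite normfZV.
Qed.

Lemma dual_norm_le_pos V (f : dual V) M :
  (forall x, `|x| <= 1 -> f x <= M) -> `|f| <= M.
Proof.
move=> fM; apply: dual_norm_le => [|x x1].
  by have := fM 0; rewrite linear0 normr0 ler01 => /(_ isT).
rewrite ler_norml fM// andbT lerNl -(linearN f).
by apply: fM; rewrite normrN.
Qed.

Lemma norming_functional V (v : V) :
  exists2 f : dual V, `|f| <= 1 & f v = `|v|.
Proof.
have ns : sublinear (fun x : V => `|x|).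
  by split=> [|a x a0]; [exact: ler_normD|rewrite normrZ gtr0_norm].
have [phi phi1 phiv] := hahn_banach v ns.
have phic : continuous phi.
  apply: nonexpansive_continuous => x y.
  by rewrite -linearB ler_norml phi1 andbT lerNl -(linearN phi) -normrN.
exists (Dual (linearP phi) phic) => //; apply: dual_norm_le_pos => x.
exact: le_trans (phi1 x).
Qed.

Section pullback.
Context V W (T : {linear V -> W}) (T1 : forall x, `|T x| <= `|x|).

Definition pullback (f : dual W) : dual V.
Proof.
apply: (@Dual _ _ (f \o T)) => [a x y|x]; first by rewrite /= !linearP.
apply: continuous_comp; last exact: dual_continuous.
by apply: nonexpansive_continuous => y z; rewrite -linearB.
Defined.

Lemma pullbackE f x : pullback f x = f (T x). Proof. by []. Qed.

Lemma pullback_linear : linear pullback.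
Proof. by move=> a f g; exact: dual_eqP. Qed.

HB.instance Definition _ :=
  GRing.isLinear.Build R (dual W) (dual V) _ pullback pullback_linear.

Lemma pullback_norm f : `|pullback f| <= `|f|.
Proof.
apply: dual_norm_le => // x x1.
exact: (@dual_norm_ub _ _ f (T x) (le_trans (T1 x) x1)).
Qed.

Lemma pullback_continuous : continuous pullback.
Proof.
apply: nonexpansive_continuous => f g.
by rewrite -linearB; exact: pullback_norm.
Qed.

End pullback.
End dual_space.

(** * Norming subspaces *)

Section norming.
Context (R : realType).
Implicit Types V : normedModType R.

Lemma submod_closedP (V : lmodType R) (F : set V) : submod_closed [in F] <->
  F 0 /\ forall a f g, F f -> F g -> F (a *: f + g).
Proof.
split=> [[F0 Fl]|[F0 Fl]]; split.
- by move: F0; rewrite !inE.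
- by move=> a f g Ff Fg; have := Fl a f g; rewrite !inE; exact.
- by rewrite !inE.
- by move=> a f g; rewrite !inE; exact: Fl.
Qed.

(** The quantifier over [M] replaces the extended supremum over the unit ball of
    [F]: for a subspace that supremum is the least such [M].  The restriction
    [0 <= M] matters when [F] is zero, where every [M] satisfies the bound. *)
Lemma norming_setP V (F : set (dual V)) : submod_closed [in F] ->
  norming_set (F `&` [set f | `|f| <= 1]) <->
  (forall x M, 0 <= M -> (forall f, F f -> f x <= M * `|f|) -> `|x| <= M).
Proof.
move=> /submod_closedP[F0 Fl]; split=> [[_ Fx] x M M0 FM|FM].
  rewrite -lee_fin Fx; apply: ge_ereal_sup => _ [f [Ff /= f1] <-].
  by rewrite lee_fin (le_trans (FM f Ff))// ler_piMr.
split=> [f []//|x]; set E := [set _ | _ in _].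
have E0 : E 0%:E by exists 0 => //; split=> //=; rewrite normr0.
have supx : (ereal_sup E <= `|x|%:E)%E.
  apply: ge_ereal_sup => _ [f [Ff /= f1] <-].
  by rewrite lee_fin (le_trans (dual_le f x))// ler_piMl.
have sup0 : (0 <= ereal_sup E)%E by exact: ereal_sup_ubound.
apply/le_anti; rewrite supx andbT.
have supE : ereal_sup E = (fine (ereal_sup E))%:E.
  by rewrite fineK// ge0_fin_numE// (le_lt_trans supx)// ltry.
rewrite supE lee_fin; apply: FM => [|f Ff]; first exact: fine_ge0.
have [->|f0] := eqVneq f 0; first by rewrite normr0 mulr0.
rewrite -ler_pdivrMr ?normr_gt0// -lee_fin -supE; apply: ereal_sup_ubound.
exists (`|f|^-1 *: f); last by rewrite mulrC.
split; first by rewrite -[_ *: _]addr0; exact: Fl.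
by rewrite /= normfZV.
Qed.

End norming.

(** * The dual of a c0-sum *)

Section c0sum_maps.
Context (R : realType) (I : Type) (X : I -> normedModType R).
Implicit Types (i j : I) (A : set I) (x : c0sum X).

Lemma c0sum_le x i : `|x i| <= `|x|. Proof. exact: c0sum_norm_ub. Qed.

Definition proj i x := x i.

Lemma proj_linear i : linear (proj i). Proof. by []. Qed.

HB.instance Definition _ i :=
  GRing.isLinear.Build R (c0sum X) (X i) _ (proj i) (proj_linear i).

Lemma trunc_subproof A x (e : R) : 0 < e ->
  finite_set [set i | e < `|if pselect (A i) then x i else 0|].
Proof.
move=> e0; apply: sub_finite_set (c0sum_finite x e0) => i /=.
by case: pselect => //= _; rewrite normr0 ltNge ltW.
Qed.

Definition trunc A x : c0sum X := C0sum (trunc_subproof A x).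

Lemma truncE A x i : trunc A x i = if pselect (A i) then x i else 0.
Proof. by []. Qed.

Lemma trunc_linear A : linear (trunc A).
Proof.
move=> a x y; apply: c0sum_eqP => i.
have -> : (a *: trunc A x + trunc A y) i = a *: trunc A x i + trunc A y i.
  by [].
rewrite !truncE; case: pselect => // ?.
by rewrite scaler0 addr0.
Qed.

HB.instance Definition _ A :=
  GRing.isLinear.Build R (c0sum X) (c0sum X) _ (trunc A) (trunc_linear A).

Lemma trunc_norm A x : `|trunc A x| <= `|x|.
Proof.
apply: c0sum_norm_le => // i; rewrite truncE.
by case: pselect => //= _; [exact: c0sum_le|rewrite normr0].
Qed.

(** The index type carries no decidable equality, so the vector [u : X i] is
    transported along a classically obtained proof of [i = j]. *)
Definition single_fun i (u : X i) j : X j :=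
  if pselect (i = j) is left ij then ecast k (X k) ij u else 0.

Lemma single_fun_diag i (u : X i) : single_fun u i = u.
Proof.
rewrite /single_fun; case: pselect => // ii.
by rewrite (Prop_irrelevance ii erefl).
Qed.

Lemma single_fun_off i (u : X i) j : i <> j -> single_fun u j = 0.
Proof. by rewrite /single_fun; case: pselect. Qed.

Lemma single_subproof i (u : X i) (e : R) : 0 < e ->
  finite_set [set j | e < `|single_fun u j|].
Proof.
move=> e0; apply: (@sub_finite_set _ _ [set i]) => // j /=.
have [ij _|ij] := pselect (i = j); first exact: esym.
by rewrite single_fun_off// normr0 ltNge ltW.
Qed.

Definition single i (u : X i) : c0sum X := C0sum (single_subproof u).

Lemma single_diag i (u : X i) : single u i = u.
Proof. exact: single_fun_diag. Qed.

Lemma single_off i (u : X i) j : i <> j -> single u j = 0.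
Proof. exact: single_fun_off. Qed.

Lemma single_linear i : linear (@single i).
Proof.
move=> a u v; apply: c0sum_eqP => j.
have -> : (a *: single u + single v) j = a *: single u j + single v j.
  by [].
have [<-|ij] := pselect (i = j); first by rewrite !single_diag.
by rewrite !single_off// scaler0 addr0.
Qed.

HB.instance Definition _ i :=
  GRing.isLinear.Build R (X i) (c0sum X) _ (@single i) (@single_linear i).

Lemma single_norm i (u : X i) : `|single u| <= `|u|.
Proof.
apply: c0sum_norm_le => // j.
have [<-|ij] := pselect (i = j); first by rewrite single_diag.
by rewrite single_off// normr0.
Qed.

Lemma proj_norm i x : `|proj i x| <= `|x|. Proof. exact: c0sum_le. Qed.

Local Notation coord i := (pullback (proj_norm i)).
Local Notation restr i := (pullback (@single_norm i)).
Local Notation trunc_dual A := (pullback (trunc_norm A)).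

Lemma coordK i (g : dual (X i)) : restr i (coord i g) = g.
Proof.
by apply: dual_eqP => u; rewrite !pullbackE; congr (g _); exact: single_diag.
Qed.

Lemma restr_coord0 i j (g : dual (X j)) : i <> j -> restr i (coord j g) = 0.
Proof.
move=> ij; apply: dual_eqP => u; rewrite !pullbackE.
by transitivity (g 0); [congr (g _); exact: single_off|exact: linear0].
Qed.

Lemma trunc_dual_set1 i (f : dual (c0sum X)) :
  trunc_dual [set i] f = coord i (restr i f).
Proof.
apply: dual_eqP => x; rewrite !pullbackE; congr (f _).
apply: c0sum_eqP => j; rewrite truncE; have [<-|ij] := pselect (i = j).
  by case: pselect => [?|[]//]; exact/esym/single_diag.
by case: pselect => [/esym//|?]; exact/esym/single_off.
Qed.

(** Gluing [x] on [A] to [y] off [A] gives a vector [z] of the unit ball, and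
    [f z] is the sum of the values at [x] and [y] of the two parts of [f]. *)
Lemma trunc_dual_l1 A (f : dual (c0sum X)) :
  `|trunc_dual A f| + `|f - trunc_dual A f| <= `|f|.
Proof.
rewrite -lerBrDr; apply: dual_norm_le_pos => x x1.
rewrite lerBrDl -lerBrDr; apply: dual_norm_le_pos => y y1.
pose z := trunc A x + (y - trunc A y).
have z1 : `|z| <= 1.
  apply: c0sum_norm_le => // i.
  have -> : z i = trunc A x i + (y i - trunc A y i) by [].
  rewrite !truncE; case: pselect => ?.
    by rewrite subrr addr0 (le_trans (c0sum_le _ _)).
  by rewrite add0r subr0 (le_trans (c0sum_le _ _)).
have fz : f z <= `|f| by rewrite (le_trans (dual_le f z))// ler_piMr.
have -> : (f - trunc_dual A f) y = f y - f (trunc A y) by [].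
by rewrite lerBrDl; move: fz; rewrite /z linearD linearB.
Qed.

(** The case of one index of [trunc_dual_l1]: restricting a functional that
    depends on the [i]-th coordinate only does not decrease its norm. *)
Lemma coord_restr_l1 i (f : dual (c0sum X)) :
  `|restr i f| + `|f - coord i (restr i f)| <= `|f|.
Proof.
apply: le_trans (trunc_dual_l1 [set i] f); rewrite trunc_dual_set1 lerD2r.
by rewrite -[in leLHS](coordK (restr i f)) pullback_norm.
Qed.

(** A vector [x] almost norming [f] has only finitely many coordinates that are
    not small; the truncation of [f] to these already has almost full norm, so
    [trunc_dual_l1] leaves little for the rest of [f]. *)
Lemma trunc_dual_dense (f : dual (c0sum X)) (e : R) : 0 < e ->
  exists2 A, finite_set A & `|f - trunc_dual A f| <= e.
Proof.
move=> e0; have e20 : 0 < e / 2 by rewrite divr_gt0.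
have [x x1 fx] : exists2 x, `|x| <= 1 & `|f| - e / 2 < f x.
  apply: contrapT => nx; suff : `|f| <= `|f| - e / 2 by lra.
  apply: dual_norm_le_pos => x x1; rewrite leNgt; apply/negP => fx.
  by apply: nx; exists x.
(* With this threshold, dropping the coordinates below [d] costs [f] at most
   [e / 2]. *)
pose d := e / 2 / (`|f| + 1).
have f1 : 0 < `|f| + 1 by rewrite ltr_wpDl.
have d0 : 0 < d by rewrite divr_gt0.
exists [set i | d < `|x i|]; first exact: c0sum_finite.
set A := [set _ | _]; have xA : `|x - trunc A x| <= d.
  apply: c0sum_norm_le => [|i]; first exact: ltW.
  have -> : (x - trunc A x) i = x i - trunc A x i by [].
  rewrite truncE; case: pselect => Ai; first by rewrite subrr normr0 ltW.
  by rewrite subr0 leNgt; exact/negP.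
have fA : f (x - trunc A x) <= e / 2.
  apply: le_trans (dual_le _ _) _; rewrite -[leRHS](divfK (lt0r_neq0 f1)) -/d.
  by rewrite mulrC ler_pM// ler_wpDr.
have := trunc_dual_l1 A f; have := dual_le (trunc_dual A f) x.
have : `|trunc_dual A f| * `|x| <= `|trunc_dual A f| by rewrite ler_piMr.
rewrite pullbackE; move: fA; rewrite linearB; lra.
Qed.

Lemma linear_trunc_dual0 (phi : {linear dual (c0sum X) -> R^o}) A :
  (forall i g, phi (coord i g) = 0) -> finite_set A ->
  forall f, phi (trunc_dual A f) = 0.
Proof.
move=> phi0 /(@finite_seqP {classic I})[s ->].
elim: s => [|i s IHs] f.
  rewrite (_ : trunc_dual _ f = 0) ?linear0//; apply: dual_eqP => x.
  transitivity (f 0); last exact: linear0.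
  by congr (f _); apply: c0sum_eqP => j; rewrite truncE; case: pselect.
have [si|si] := boolP (i \in s).
  rewrite -(IHs f); congr (phi (trunc_dual _ f)); apply/seteqP.
  by split=> j /=; rewrite inE; [case/predU1P=> [->|]|move=> ->; rewrite orbT].
rewrite (_ : trunc_dual _ f = trunc_dual [set` s] f + coord i (restr i f)).
  by rewrite linearD IHs phi0 addr0.
rewrite -trunc_dual_set1; apply: dual_eqP => x.
transitivity (f (trunc [set` s] x) + f (trunc [set i] x)) => //.
rewrite -linearD; congr (f _); apply: c0sum_eqP => j.
have -> : (trunc [set` s] x + trunc [set i] x) j =
  trunc [set` s] x j + trunc [set i] x j by [].
have [ij|ij] := pselect (j = i).
  have sj : ~ [set` s] j by rewrite ij; exact/negP.
  have isj : [set` i :: s] j by rewrite /= inE ij eqxx.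
  rewrite !truncE; case: pselect => // ?; case: pselect => // ?.
  by case: pselect => // ?; rewrite add0r.
rewrite !truncE; have [sj|sj] := boolP ((j : {classic I}) \in s).
  case: pselect => [?|[]]; last by rewrite /= inE sj orbT.
  by case: pselect => // ?; case: pselect => // ?; rewrite addr0.
case: pselect => [/=|?]; first by rewrite inE (negPf sj) orbF => /eqP.
case: pselect => [/=|?]; first by rewrite (negPf sj).
by case: pselect => // ?; rewrite addr0.
Qed.

(** Finite truncations of [f] are sums of functionals of one coordinate, and
    they approximate [f] in norm. *)
Lemma coord_total (phi : {linear dual (c0sum X) -> R^o}) :
  (forall f, phi f <= `|f|) -> (forall i g, phi (coord i g) = 0) ->
  forall f, phi f = 0.
Proof.
move=> phi1 phi0.
suff phile0 f : phi f <= 0.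
  by move=> f; apply/le_anti; rewrite phile0 -oppr_le0 -(linearN phi) phile0.
apply/ler_addgt0Pl => e e0; rewrite addr0.
have [A fA Ae] := trunc_dual_dense f e0; apply: le_trans Ae.
apply: le_trans (phi1 _); rewrite linearB.
by rewrite (linear_trunc_dual0 phi0 fA) subr0.
Qed.

End c0sum_maps.

(** * Separating a point from a closed subspace *)

Section separation.
Context (R : realType) (V : normedModType R).

(** Hahn-Banach for the distance to [F], which is sublinear, vanishes on [F] and
    is positive at [v]. *)
Lemma separating_functional (F : set V) v : submod_closed [in F] -> closed F ->
  ~ F v -> exists phi : {linear V -> R^o},
  [/\ forall x, phi x <= `|x|, forall x, F x -> phi x = 0 & phi v != 0].
Proof.
move=> /submod_closedP[F0 Fl] Fc Fv.
pose S := [set (fun x => `|x - y|) | y in F].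
have lS x : has_lbound [set q x | q in S].
  by exists 0 => _ [_ [y _ <-] <-].
have dle x y : F y -> pointwise_inf S x <= `|x - y|.
  move=> Fy.
  by apply: (@pointwise_inf_le _ _ S (fun x => `|x - y|)) => //; exists y.
have [|phi phid phiv] := @hahn_banach R V (pointwise_inf S) v.
  apply: pointwise_inf_sublinear => // [|_ _ x y [s Fs <-] [t Ft <-]|
      _ a x [t Ft <-] a0].
  - by exists (fun x => `|x - 0|), 0.
  - exists (fun x => `|x - (s + t)|).
      by exists (s + t) => //; rewrite -[s]scale1r; exact: Fl.
    by rewrite opprD addrACA ler_normD.
  - exists (fun x => `|x - a *: t|).
      by exists (a *: t) => //; rewrite -[_ *: _]addr0; exact: Fl.
    by rewrite -scalerBr normrZ gtr0_norm.
have phi0 x : F x -> phi x <= 0.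
  move=> Fx; rewrite (le_trans (phid x))// (le_trans (dle x x Fx))//.
  by rewrite subrr normr0.
exists phi; split=> [x|x Fx|].
- by rewrite (le_trans (phid x))// (le_trans (dle x 0 F0))// subr0.
- apply/le_anti; rewrite phi0//= -oppr_le0 -(linearN phi) phi0//.
  by rewrite -scaleN1r -[_ *: _]addr0; exact: Fl.
- rewrite phiv; apply/eqP => d0; apply: Fv.
  apply: Fc => B /nbhs_ballP[e /= e0 eB].
  have [_ [_ [y Fy <-] <-]] : exists2 d, [set q v | q in S] d & d < e.
    apply: inf_lt; last by rewrite -[inf _]/(pointwise_inf S v) d0.
    by exists `|v - 0|, (fun x => `|x - 0|) => //; exists 0.
  by move=> vy; exists y; split=> //; apply: eB; rewrite -ball_normE.
Qed.

End separation.

(** * Transfer of norming subspaces between a c0-sum and its summands *)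

Section c0sum_norming.
Context (R : realType) (I : Type) (X : I -> normedModType R).

Local Notation coord i := (pullback (@proj_norm R I X i)).
Local Notation restr i := (pullback (@single_norm R I X i)).

(** Coordinates other than [i] need norming too: a functional of such a
    coordinate restricts to [0 \in G]. *)
Lemma norming_subspace_restr i (G : set (dual (X i))) :
  norming_subspace G -> norming_subspace (restr i @^-1` G).
Proof.
move=> [Gl Gc Gn]; have /submod_closedP[G0 Gs] := Gl.
have Fl : submod_closed [in restr i @^-1` G].
  apply/submod_closedP; split=> [|a f g Ff Fg] /=; first by rewrite linear0.
  by rewrite linearP; exact: Gs.
split=> //.
  apply: preimage_closed => // f _; exact: pullback_continuous.
apply/norming_setP => // x M M0 xM; apply: c0sum_norm_le => // j.
have [ij|ij] := pselect (i = j); last first.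
  have [g g1 <-] := norming_functional (x j).
  have := xM (coord j g); rewrite /= restr_coord0// => /(_ G0) /le_trans; apply.
  by rewrite ler_piMr// (le_trans (pullback_norm _ _)).
case: _ / ij; have /norming_setP Gn' := Gl; apply: (Gn'.1 Gn) => // g Gg.
have := xM (coord i g); rewrite /= coordK => /(_ Gg) /le_trans; apply.
by rewrite ler_wpM2l// pullback_norm.
Qed.

(** Given [f] in [F] with restriction [g], subtracting from [g] a multiple of
    [h] of norm comparable to [`|f| - `|g|] puts it into the kernel.
    A bound [M] for [x] on the kernel thus bounds [f] at [single x] by
    [M * `|g| + K * (`|f| - `|g|)], and [`|g| * `|x|] is another bound.  If
    [M < `|x|], a convex combination of the two bounds is at most
    [M' * `|f|] for some [M' < `|x|], although [F] norms [single x]. *)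
Lemma norming_subspace_ker (F : set (dual (c0sum X)))
    (phi : {linear dual (c0sum X) -> R^o}) i h :
  norming_subspace F -> (forall f, phi f <= `|f|) ->
  (forall f, F f -> phi f = 0) -> phi (coord i h) != 0 ->
  norming_subspace [set g | phi (coord i g) = 0].
Proof.
move=> [Fl _ Fn] phi1 phiF phih; set G := [set g | _].
have phi_norm f : `|phi f| <= `|f|.
  by rewrite ler_norml phi1 andbT lerNl -(linearN phi) -normrN.
have Gl : submod_closed [in G].
  apply/submod_closedP; split=> [|a f g Gf Gg]; rewrite /G /=.
    by rewrite !linear0.
  by rewrite !linearP Gf Gg scaler0 addr0.
split=> //.
  have -> : G = (fun g => phi (coord i g) : R) @^-1` [set 0] by [].
  apply: preimage_closed => [g _|]; last exact: closed_eq.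
  apply: nonexpansive_continuous => f g'; rewrite -!linearB.
  by apply: le_trans (phi_norm _) _; exact: pullback_norm.
apply/norming_setP => // x M M0 xM.
rewrite leNgt; apply/negP => Mx.
pose k := (phi (coord i h))^-1 *: h.
have phik : phi (coord i k) = 1 by rewrite !linearZ; exact: mulVf.
pose K := `|k| * (M + `|x|).
have K0 : 0 <= K by rewrite mulr_ge0// addr_ge0.
have x0 : 0 < `|x| by exact: le_lt_trans Mx.
have bound f : F f -> f (single x) <= M * `|restr i f| +
    K * (`|f| - `|restr i f|).
  move=> Ff; set g := restr i f; pose c := phi (coord i g).
  have cle : `|c| <= `|f| - `|g|.
    have -> : c = - phi (f - coord i g) by rewrite linearB phiF// sub0r opprK.
    rewrite normrN (le_trans (phi_norm _))// lerBrDl.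
    exact: coord_restr_l1.
  have Gg : G (g - c *: k).
    rewrite /G /= 2!linearB 2!linearZ phik; apply/eqP; rewrite subr_eq0 eq_sym.
    exact/eqP/mulr1.
  have gx : g x = (g - c *: k) x + c * k x.
    by rewrite [(g - _) x]/(g x - c * k x) subrK.
  have -> : f (single x) = g x by [].
  have kx : c * k x <= `|c| * (`|k| * `|x|).
    rewrite (le_trans (ler_norm _))// normrM ler_wpM2l//.
    by rewrite ler_norml dual_le andbT lerNl -linearN -[`|x|]normrN dual_le.
  have gk : `|g - c *: k| <= `|g| + `|c| * `|k|.
    by rewrite (le_trans (ler_normB _ _))// normrZ.
  have := xM _ Gg; have := ler_wpM2l M0 gk; have := ler_wpM2r K0 cle.
  rewrite gx /K; lra.
(* The weight of the first bound in the convex combination, small enough for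
   the coefficient [l * K] of [`|f| - `|g|] not to exceed that of [`|g|]. *)
pose l := `|x| / (K + `|x|).
have Kx : 0 < K + `|x| by rewrite ltr_wpDl.
have l0 : 0 < l by rewrite divr_gt0.
have l1 : l <= 1 by rewrite ler_pdivrMr// mul1r lerDr.
pose M' := (1 - l) * `|x| + l * M.
have lK : l * K <= M'.
  rewrite /M'; have : l * (K + `|x|) = `|x| by rewrite divfK ?gt_eqF.
  have : 0 <= l * M by rewrite mulr_ge0// ltW.
  lra.
have M'x : M' < `|x|.
  by have := Mx; rewrite -(ltr_pM2l l0) /M'; lra.
have M'0 : 0 <= M' by rewrite addr_ge0// mulr_ge0// ?subr_ge0// ltW.
suff sx : `|single x : c0sum X| <= M'.
  have := le_lt_trans (le_trans (c0sum_le (single x) i) sx) M'x.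
  by rewrite single_diag ltxx.
have /norming_setP Fn' := Fl; apply: (Fn'.1 Fn) => // f Ff.
have fx : f (single x) <= `|restr i f| * `|x| by exact: (dual_le (restr i f) x).
have rf : 0 <= `|f| - `|restr i f| by rewrite subr_ge0 pullback_norm.
have l1' : 0 <= 1 - l by rewrite subr_ge0.
have := ler_wpM2r rf lK; have := ler_wpM2l (ltW l0) (bound f Ff).
have := ler_wpM2l l1' fx; rewrite /M'; lra.
Qed.

End c0sum_norming.

(** * Nice smoothness of c0-sums *)

Theorem theorem11 (R : realType) (Gamma : Type)
    (X : Gamma -> completeNormedModType R) :
  nicely_smooth (c0sum X) <-> (forall alpha : Gamma, nicely_smooth (X alpha)).
Proof.
split=> [Xs alpha [G Gn GT]|Xs [F Fn [_ /existsNP[v /not_implyP[_ Fv]]]]].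
  case: GT => _ /existsNP[g /not_implyP[_ Gg]].
  apply: Xs; exists (pullback (@single_norm _ _ X alpha) @^-1` G).
    exact: norming_subspace_restr.
  split=> // /(_ (pullback (@proj_norm _ _ X alpha) g) I).
  by rewrite /= coordK.
have [Fl Fc _] := Fn.
have [phi [phi1 phiF phiv]] := separating_functional Fl Fc Fv.
move/eqP: phiv; apply; apply: coord_total => // alpha h.
apply: contrapT => /eqP phih.
apply: (Xs alpha).
exists [set g | phi (pullback (@proj_norm _ _ X alpha) g) = 0].
  exact: norming_subspace_ker Fn phi1 phiF phih.
by split=> // /(_ h I); exact/eqP.
Qed.
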